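(* Let $\Gamma$ be a discrete amenable group. Then for all $n>0$ and all $p\in\{1,2,\dots,n\}$ the comparison homomorphism $$H^n_{(p)}(\Gamma;\mathbf{R})\to H^n_{(p-1)}(\Gamma;\mathbf{R})$$ (induced by the inclusion of $p$-bounded cochains into $(p-1)$-bounded cochains) is the zero map.
   Context: $C^n(\Gamma;\mathbf{R})$ is the space of all functions $\Gamma^n\to\mathbf{R}$ (nonhomogeneous cochains, trivial real coefficients), with codifferential $$\delta\alpha(g_1,\dots,g_{n+1})=\alpha(g_2,\dots,g_{n+1})+\sum_{k=1}^{n}(-1)^k\alpha(g_1,\dots,g_kg_{k+1},\dots,g_{n+1})+(-1)^{n+1}\alpha(g_1,\dots,g_n).$$ For $0\le p\le n$, a cochain $\omega\colon\Gamma^n\to\mathbf{R}$ is called $p$-bounded if for all fixed $g_{p+1},\dots,g_n\in\Gamma$ the function $(g_1,\dots,g_p)\mapsto\omega(g_1,\dots,g_p,g_{p+1},\dots,g_n)$ on $\Gamma^p$ is bounded. For $n<p$, a $p$-bounded $n$-cochain means a bounded $n$-cochain. The $p$-bounded cochains form a subcomplex $C^*_{(p)}(\Gamma;\mathbf{R})\subseteq C^*(\Gamma;\mathbf{R})$, whose cohomology is denoted $H^*_{(p)}(\Gamma;\mathbf{R})$. Thus $H^n_{(n)}(\Gamma;\mathbf{R})=H^n_b(\Gamma;\mathbf{R})$ is bounded cohomology and $H^n_{(0)}(\Gamma;\mathbf{R})=H^n(\Gamma;\mathbf{R})$ is ordinary group cohomology. *)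

(* Defs.v *)
From HB Require Import structures.
From mathcomp Require Import all_boot all_order all_algebra.
From mathcomp Require Import ring_quotient zify.
From mathcomp Require Import all_classical all_reals all_analysis.

Set Implicit Arguments.
Unset Strict Implicit.
Unset Printing Implicit Defensive.

Import Order.TTheory GRing.Theory Num.Theory.
Import numFieldNormedType.Exports.

Local Open Scope classical_set_scope.
Local Open Scope ring_scope.
Local Open Scope quotient_scope.

(* The values of [m] at unbounded functions are irrelevant: a mean is a
   functional on the space of bounded functions. *)
Definition left_invariant_mean (R : realType) (G : groupType)
    (m : (G -> R) -> R) : Prop :=
  [/\ forall (a : R) (f h : G -> R), bounded_fun f -> bounded_fun h ->
        m (fun x => a * f x + h x) = a * m f + m h,
      forall f : G -> R, bounded_fun f -> (forall x, 0 <= f x) -> 0 <= m f,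
      m (fun=> 1) = 1 &
      forall (g : G) (f : G -> R), bounded_fun f ->
        m (fun x => f (g * x)%g) = m f].

Definition amenable (R : realType) (G : groupType) : Prop :=
  exists m : (G -> R) -> R, left_invariant_mean m.

(* A [submodClosed] predicate does not carry a [zmodClosed] structure, which
   [Quotient.quot] requires, hence the alias [submod_pred]. *)
Section LinearQuotient.
Variables (K : pzRingType) (V : lmodType K) (W : submodClosed V).

Definition submod_pred : {pred V} := W.

HB.instance Definition _ := GRing.isZmodClosed.Build V submod_pred
  (GRing.submod_closedB (submodClosedP W)).

Definition lquot := Quotient.quot submod_pred.

HB.instance Definition _ := GRing.Zmodule.on lquot.

Definition lquot_pi : V -> lquot := \pi_lquot.

Definition lquot_repr : lquot -> V := repr.

Lemma lquot_reprK : cancel lquot_repr lquot_pi.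
Proof. exact: reprK. Qed.

Lemma lquot_piP u v : lquot_pi u = lquot_pi v <-> u - v \in W.
Proof.
have := Quotient.idealrBE submod_pred u v.
by rewrite {1}/submod_pred => ->; split=> [/eqP|/eqP].
Qed.

Fact lquot_pi_zmod : zmod_morphism lquot_pi.
Proof. exact: raddfB. Qed.

HB.instance Definition _ :=
  GRing.isZmodMorphism.Build V lquot lquot_pi lquot_pi_zmod.

Definition lquot_scale (a : K) (x : lquot) : lquot :=
  lquot_pi (a *: lquot_repr x).

Lemma lquot_scale_pi a v : lquot_scale a (lquot_pi v) = lquot_pi (a *: v).
Proof.
apply/lquot_piP; rewrite -scalerBr rpredZ//.
by apply/lquot_piP; rewrite lquot_reprK.
Qed.

Fact lquot_scaleA a b x :
  lquot_scale a (lquot_scale b x) = lquot_scale (a * b) x.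
Proof. by rewrite -[x]lquot_reprK !lquot_scale_pi scalerA. Qed.

Fact lquot_scale1 : left_id 1 lquot_scale.
Proof. by move=> x; rewrite -[x]lquot_reprK lquot_scale_pi scale1r. Qed.

Fact lquot_scaleDr : right_distributive lquot_scale +%R.
Proof.
move=> a x y; rewrite -[x]lquot_reprK -[y]lquot_reprK -raddfD !lquot_scale_pi.
by rewrite scalerDr raddfD.
Qed.

Fact lquot_scaleDl x : {morph lquot_scale^~ x : a b / a + b}.
Proof.
by move=> a b; rewrite -[x]lquot_reprK !lquot_scale_pi scalerDl raddfD.
Qed.

HB.instance Definition _ := GRing.Zmodule_isLmodule.Build K lquot
  lquot_scaleA lquot_scale1 lquot_scaleDr lquot_scaleDl.

Fact lquot_pi_scalable : scalable lquot_pi.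
Proof. by move=> a v; rewrite -lquot_scale_pi. Qed.

HB.instance Definition _ :=
  GRing.isScalable.Build K V lquot _ lquot_pi lquot_pi_scalable.

End LinearQuotient.

Section Cochains.
Variables (R : realType) (G : groupType).

Definition cochain (n : nat) := ('I_n -> G) -> R^o.

HB.instance Definition _ n := GRing.Lmodule.on (cochain n).

(* (g_1, ..., g_{n+1}) |-> (g_1, ..., g_k g_{k+1}, ..., g_{n+1}), where the
   indices are shifted by one: [k : 'I_n] stands for k + 1. *)
Definition contract n (k : 'I_n) (g : 'I_n.+1 -> G) : 'I_n -> G := fun i =>
  if (i < k)%N then g (widen_ord (leqnSn n) i)
  else if i == k then (g (widen_ord (leqnSn n) i) * g (lift ord0 i))%g
  else g (lift ord0 i).

Definition codiff n (w : cochain n) : cochain n.+1 := fun g =>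
  w (fun i => g (lift ord0 i))
  + \sum_(k < n) (-1) ^+ k.+1 * w (contract k g)
  + (-1) ^+ n.+1 * w (fun i => g (widen_ord (leqnSn n) i)).

(* Coordinates are numbered from 0, so g_{p+1}, ..., g_n are those of index
   at least p; when n <= p no coordinate is fixed. *)
Definition p_bounded (p n : nat) (w : cochain n) : Prop :=
  forall c : 'I_n -> G,
    [bounded w g | g in [set g | forall i : 'I_n, (p <= i)%N -> g i = c i]].

Lemma p_boundedP p n (w : cochain n) : p_bounded p w <->
  forall c : 'I_n -> G, exists M : R, forall g : 'I_n -> G,
    (forall i : 'I_n, (p <= i)%N -> g i = c i) -> `|w g| <= M.
Proof.
have PF (c : 'I_n -> G) : ProperFilter
    (globally [set g : 'I_n -> G | forall i : 'I_n, (p <= i)%N -> g i = c i]).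
  exact: (@globally_properfilter _ _ c).
by split=> wb c; [have /ex_bound := wb c|apply/ex_bound; exact: wb].
Qed.

Lemma p_bounded0 n (w : cochain n) : p_bounded 0 w.
Proof.
apply/p_boundedP => c; exists `|w c| => g gc.
by rewrite (_ : g = c)//; apply/funext => i; exact: gc.
Qed.

Lemma p_bounded_ge p n (w : cochain n) :
  (n <= p)%N -> p_bounded p w <-> bounded_fun w.
Proof.
move=> np; split=> [wb|wb c]; last first.
  by apply: sub_boundedr wb => A AT g _; exact: AT.
have [M wM] := (p_boundedP p w).1 wb (fun=> 1%g).
have PF : ProperFilter (globally [set: 'I_n -> G]).
  exact: (@globally_properfilter _ _ (fun=> 1%g)).
apply/ex_bound; exists M => g _; apply: wM => i pi.
by have := leq_ltn_trans (leq_trans np pi) (ltn_ord i); rewrite ltnn.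
Qed.

Lemma p_bounded_pred p n (w : cochain n) : p_bounded p w -> p_bounded p.-1 w.
Proof.
move=> /p_boundedP wb; apply/p_boundedP => c; have [M wM] := wb c.
by exists M => g gc; apply: wM => i pi; apply/gc/(leq_trans (leq_pred p)).
Qed.

Fact p_bounded_submod p n : submod_closed [pred w : cochain n | `[< p_bounded p w >]].
Proof.
split=> [|a u v /asboolP/p_boundedP ub /asboolP/p_boundedP vb].
  by apply/asboolP/p_boundedP => c; exists 0 => g _; rewrite normr0.
apply/asboolP/p_boundedP => c.
have [M uM] := ub c; have [N vN] := vb c.
exists (`|a| * M + N) => g gc; rewrite (le_trans (ler_normD _ _))// lerD//.
  by rewrite normrM ler_wpM2l// uM.
exact: vN.
Qed.

Definition face n (k : nat) (g : 'I_n.+1 -> G) : 'I_n -> G := fun i =>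
  if (i.+1 < k)%N then g (widen_ord (leqnSn n) i)
  else if i.+1 == k then (g (widen_ord (leqnSn n) i) * g (lift ord0 i))%g
  else g (lift ord0 i).

Lemma codiffE n (w : cochain n) g :
  codiff w g = \sum_(k < n.+2) (-1) ^+ k * w (face k g).
Proof.
rewrite big_ord_recl big_ord_recr /= expr0 mul1r addrA /codiff.
congr (w _ + _ + _ * w _) => //.
apply/funext => i; rewrite /face /bump /= add1n ltnS.
by rewrite ltn_ord.
Qed.

Lemma face_face n j k (g : 'I_n.+2 -> G) : (j <= k)%N ->
  face j (face k.+1 g) = face k (face j g).
Proof.
move=> jk; apply/funext => i; rewrite /face /= /bump /= !add1n.
have e : widen_ord (leqnSn n.+1) (lift ord0 i)
   = lift ord0 (widen_ord (leqnSn n) i) by apply/val_inj.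
rewrite e.
do ![case: ifP => ?]; rewrite ?mulgA //; lia.
Qed.

Lemma codiff_codiff n (w : cochain n) : codiff (codiff w) = 0.
Proof.
apply/funext => g; rewrite codiffE.
pose F (x : 'I_n.+3 * 'I_n.+2) : R^o :=
  (-1) ^+ x.1 * ((-1) ^+ x.2 * w (face x.2 (face x.1 g))).
transitivity (\sum_x F x).
  by rewrite -(pair_bigA _ (fun k j => F (k, j)))/=; apply: eq_bigr => k _;
     rewrite codiffE mulr_sumr.
rewrite (bigID (fun x : 'I_n.+3 * 'I_n.+2 => (x.2 < x.1)%N)) /=.
pose h (x : 'I_n.+3 * 'I_n.+2) : 'I_n.+3 * 'I_n.+2 :=
  (lift ord0 x.2, inord x.1).
pose h' (x : 'I_n.+3 * 'I_n.+2) : 'I_n.+3 * 'I_n.+2 :=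
  (widen_ord (leqnSn _) x.2, inord x.1.-1).
rewrite (reindex_onto h h') /=; last first.
  move=> [[k kn] [j jn]] /= jk; rewrite /h /h' /=; congr (_, _);
    apply/val_inj; rewrite /= ?inordK ?/bump /=; lia.
rewrite (eq_bigl (fun x : 'I_n.+3 * 'I_n.+2 => ~~ (x.2 < x.1)%N)); last first.
  move=> [[k kn] [j jn]]; rewrite /h /h' /= /bump /= add1n add0n.
  have [jk|kj] := ltnP j k.
    apply/negP => /andP[lt_k /eqP[/= e _]].
    by move: lt_k; rewrite e; lia.
  have kn2 : (k < n.+2)%N by lia.
  rewrite inordK//=; apply/andP; split; first by lia.
  by apply/eqP; congr (_, _); apply/val_inj; rewrite /= inordK.
rewrite -big_split /= big1// => -[[k kn] [j jn]] /=; rewrite -leqNgt => kj.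
rewrite /F /h /= /bump /= add1n inordK; last by lia.
by rewrite face_face// exprS !mulrA mulN1r mulNr [_ ^+ j * _]mulrC mulNr addNr.
Qed.

Lemma p_bounded_codiff p n (w : cochain n) :
  p_bounded p w -> p_bounded p (codiff w).
Proof.
move=> /p_boundedP wb; apply/p_boundedP => c.
have /choice[M wM] (k : 'I_n.+2) : exists M : R, forall g : 'I_n.+1 -> G,
    (forall i : 'I_n.+1, (p <= i)%N -> g i = c i) -> `|w (face k g)| <= M.
  have [M wM] := wb (face k c); exists M => g gc; apply: wM => i pi.
  rewrite /face !gc//= /bump /=; lia.
exists (\sum_k M k) => g gc; rewrite codiffE (le_trans (ler_norm_sum _ _ _))//.
by apply: ler_sum => k _; rewrite normrM normrX normrN1 expr1n mul1r wM.
Qed.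

Fact codiff_linear n : linear (@codiff n).
Proof.
move=> a u v; apply/funext => g; rewrite codiffE.
transitivity (a * codiff u g + codiff v g) => //.
rewrite !codiffE mulr_sumr -big_split /=; apply: eq_bigr => k _.
by rewrite mulrCA -mulrDr.
Qed.

HB.instance Definition _ n := GRing.isLinear.Build R (cochain n)
  (cochain n.+1) _ (@codiff n) (@codiff_linear n).

Definition pcochain_pred p n : {pred cochain n} :=
  [pred w | `[< p_bounded p w >]].
Arguments pcochain_pred : clear implicits.

HB.instance Definition _ p n := GRing.isSubmodClosed.Build R (cochain n)
  (pcochain_pred p n) (GRing.submod_closed_semi (@p_bounded_submod p n)).

Record pcochain p n := PCochain {
  pcochain_val :> cochain n;
  _ : pcochain_val \in pcochain_pred p n }.

HB.instance Definition _ p n := [isSub for @pcochain_val p n].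
HB.instance Definition _ p n := [Choice of pcochain p n by <:].
HB.instance Definition _ p n := [SubChoice_isSubLmodule of pcochain p n by <:].

Fact codiff_pcochain p n (w : pcochain p n) :
  codiff w \in pcochain_pred p n.+1.
Proof. by apply/asboolP/p_bounded_codiff/asboolP/(valP w). Qed.

Definition pcodiff p n (w : pcochain p n) : pcochain p n.+1 :=
  PCochain (codiff_pcochain w).

Fact pcodiff_linear p n : linear (@pcodiff p n).
Proof. by move=> a u v; apply/val_inj; rewrite /= !linearP. Qed.

HB.instance Definition _ p n := GRing.isLinear.Build R (pcochain p n)
  (pcochain p n.+1) _ (@pcodiff p n) (@pcodiff_linear p n).

Lemma pcodiff_pcodiff p n (w : pcochain p n) : pcodiff (pcodiff w) = 0.
Proof. by apply/val_inj; rewrite /= codiff_codiff. Qed.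

Definition cocycle_pred p n : {pred pcochain p n} := [pred w | pcodiff w == 0].
Arguments cocycle_pred : clear implicits.

Fact cocycle_submod p n : submod_closed (cocycle_pred p n).
Proof.
split=> [|a u v /eqP u0 /eqP v0]; rewrite unfold_in /= ?linear0//.
apply/eqP; transitivity (a *: pcodiff u + pcodiff v); first exact: linearP.
by rewrite u0 v0 scaler0 addr0.
Qed.

HB.instance Definition _ p n := GRing.isSubmodClosed.Build R (pcochain p n)
  (cocycle_pred p n) (GRing.submod_closed_semi (@cocycle_submod p n)).

Record cocycle p n := Cocycle {
  cocycle_val :> pcochain p n;
  _ : cocycle_val \in cocycle_pred p n }.

HB.instance Definition _ p n := [isSub for @cocycle_val p n].
HB.instance Definition _ p n := [Choice of cocycle p n by <:].
HB.instance Definition _ p n := [SubChoice_isSubLmodule of cocycle p n by <:].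

Definition is_coboundary p n : pcochain p n -> Prop :=
  match n with
  | 0 => fun z => z = 0
  | m.+1 => fun z => exists a : pcochain p m, z = pcodiff a
  end.

Definition coboundary_pred p n : {pred cocycle p n} :=
  [pred z | `[< is_coboundary (cocycle_val z) >]].
Arguments coboundary_pred : clear implicits.

Fact coboundary_submod p n : submod_closed (coboundary_pred p n).
Proof.
split=> [|a u v /asboolP uB /asboolP vB]; apply/asboolP.
  by case: n => [|n] //=; exists 0; rewrite linear0.
case: n u v uB vB => [|n] u v /=; first by move=> -> ->; rewrite scaler0 addr0.
by move=> [b ->] [c ->]; exists (a *: b + c); rewrite linearP.
Qed.

HB.instance Definition _ p n := GRing.isSubmodClosed.Build R (cocycle p n)
  (coboundary_pred p n) (GRing.submod_closed_semi (@coboundary_submod p n)).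

Definition cohomology p n := lquot (coboundary_pred p n).

HB.instance Definition _ p n := GRing.Lmodule.on (cohomology p n).

Definition cohomology_class p n : cocycle p n -> cohomology p n :=
  @lquot_pi _ _ (coboundary_pred p n).

HB.instance Definition _ p n := GRing.Linear.on (@cohomology_class p n).

(* [p.-1] is truncated: for p = 0 this is the identity. *)
Fact pcochain_incl_subproof p n (w : pcochain p n) :
  pcochain_val w \in pcochain_pred p.-1 n.
Proof. by apply/asboolP/p_bounded_pred/asboolP/(valP w). Qed.

Definition pcochain_incl p n (w : pcochain p n) : pcochain p.-1 n :=
  PCochain (pcochain_incl_subproof w).

Fact cocycle_incl_subproof p n (z : cocycle p n) :
  pcochain_incl z \in cocycle_pred p.-1 n.
Proof.
have /eqP/(congr1 (@pcochain_val _ _)) z0 := valP z.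
exact/eqP/val_inj.
Qed.

Definition cocycle_incl p n (z : cocycle p n) : cocycle p.-1 n :=
  Cocycle (cocycle_incl_subproof z).

Fact cocycle_incl_linear p n : linear (@cocycle_incl p n).
Proof. by move=> a u v; apply/val_inj/val_inj. Qed.

HB.instance Definition _ p n := GRing.isLinear.Build R (cocycle p n)
  (cocycle p.-1 n) _ (@cocycle_incl p n) (@cocycle_incl_linear p n).

Definition comparison p n (x : cohomology p n) : cohomology p.-1 n :=
  cohomology_class (cocycle_incl (lquot_repr x)).

Lemma comparison_class p n (z : cocycle p n) :
  comparison (cohomology_class z) = cohomology_class (cocycle_incl z).
Proof.
apply/lquot_piP; rewrite -linearB.
have : lquot_repr (cohomology_class z) - z \in coboundary_pred p n.
  by apply/lquot_piP; rewrite lquot_reprK.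
move: (_ - z) => {}z /asboolP zB; apply/asboolP.
case: n z zB => [|n] z /= zB; first by apply/val_inj; rewrite /= zB.
by have [a za] := zB; exists (pcochain_incl a); apply/val_inj; rewrite /= za.
Qed.

Fact comparison_linear p n : linear (@comparison p n).
Proof.
move=> a x y; rewrite -[x]lquot_reprK -[y]lquot_reprK.
by rewrite -!/(cohomology_class _) -linearP !comparison_class !linearP.
Qed.

HB.instance Definition _ p n := GRing.isLinear.Build R (cohomology p n)
  (cohomology p.-1 n) _ (@comparison p n) (@comparison_linear p n).

End Cochains.

Arguments cohomology : clear implicits.
Arguments comparison : clear implicits.

(* Main.v *)
Require Import Defs.
From mathcomp Require Import all_boot all_order all_algebra.
From mathcomp Require Import all_classical all_reals all_analysis.
From mathcomp Require Import lra.

(** A mean contracts the complex by averaging over the first variable.  Let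
    [w] be a [p]-bounded cocycle of degree [n.+1], with [p > 0], let [m] be a
    mean invariant under right translations, and put
      [a (g_1, ..., g_n) = m (x |-> w (x, g_1, ..., g_n))].
    The average makes sense because [w] is bounded in its first variable.
    Since [x] takes up one of the [p] variables in which [w] is uniformly
    bounded and [m] does not increase the sup norm, [a] is still bounded in
    its first [p - 1] variables: this is exactly where one degree of
    boundedness is lost.  Now average over [x] the cocycle identity
      [w (g_1, ..., g_n.+1) = w (x g_1, g_2, ..., g_n.+1)
         - w (x, g_1 g_2, ..., g_n.+1) + ...].
    The left-hand side does not depend on [x], right invariance removes the
    factor [g_1] from the first term on the right, and the right-hand side
    becomes the coboundary of [a] ([codiff_average]).  A left invariant mean
    becomes right invariant after composition with inversion. *)

Set Implicit Arguments.
Unset Strict Implicit.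
Unset Printing Implicit Defensive.

Import Order.TTheory GRing.Theory Num.Theory.

Local Open Scope ring_scope.

Lemma bounded_funP (R : realType) (G : groupType) (f : G -> R) :
  bounded_fun f <-> exists M : R, forall x, `|f x| <= M.
Proof.
have PF : ProperFilter (globally [set: G]).
  exact: (@globally_properfilter _ _ 1%g).
split=> [/ex_bound[M fM]|[M fM]]; first by exists M => x; exact: fM.
by apply/ex_bound; exists M => x _; exact: fM.
Qed.

(** * Invariant means *)

Section Mean.
Context {R : realType} {G : groupType} {m : (G -> R) -> R}.
Hypothesis mP : left_invariant_mean m.

Lemma bounded_fun_cst (c : R) : bounded_fun (fun _ : G => c).
Proof. by apply/bounded_funP; exists `|c|. Qed.

Lemma bounded_funZD (a : R) (f h : G -> R) : bounded_fun f -> bounded_fun h ->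
  bounded_fun (fun x => a * f x + h x).
Proof.
move=> /bounded_funP[M fM] /bounded_funP[N hN].
apply/bounded_funP; exists (`|a| * M + N) => x.
by rewrite (le_trans (ler_normD _ _))// lerD// normrM ler_wpM2l.
Qed.

Lemma bounded_fun_comp (s : G -> G) (f : G -> R) :
  bounded_fun f -> bounded_fun (f \o s).
Proof.
move=> /bounded_funP[M fM]; apply/bounded_funP.
by exists M => x; exact: fM.
Qed.

Lemma mean_linear (a : R) (f h : G -> R) : bounded_fun f -> bounded_fun h ->
  m (fun x => a * f x + h x) = a * m f + m h.
Proof. by case: mP => + _ _ _; exact. Qed.

Lemma mean0 : m (fun=> 0) = 0.
Proof.
have := mean_linear 1 (bounded_fun_cst 0) (bounded_fun_cst 0).
rewrite (_ : (fun _ => _) = fun=> 0); last by apply/funext => x; lra.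
lra.
Qed.

Lemma mean_cst (c : R) : m (fun=> c) = c.
Proof.
case: mP => _ _ m1 _.
have := mean_linear c (bounded_fun_cst 1) (bounded_fun_cst 0).
rewrite m1 mean0 (_ : (fun _ => _) = fun=> c); last by apply/funext => x; lra.
lra.
Qed.

Lemma mean_sum n (a : 'I_n -> R) (f : 'I_n -> G -> R) :
  (forall k, bounded_fun (f k)) ->
  m (fun x => \sum_k a k * f k x) = \sum_k a k * m (f k).
Proof.
move=> fb.
(* The additivity of a mean is only known on bounded functions, so that the
   boundedness of the partial sums is part of the induction. *)
suff [] : bounded_fun (fun x => \sum_k a k * f k x) /\
    m (fun x => \sum_k a k * f k x) = \sum_k a k * m (f k) by [].
elim: n a f fb => [|n IHn] a f fb.
  rewrite big_ord0 (_ : (fun x => _) = fun=> 0).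
    by split; [exact: bounded_fun_cst|exact: mean0].
  by apply/funext => x; rewrite big_ord0.
have [sb ms] := IHn (fun k => a (lift ord0 k)) (fun k => f (lift ord0 k))
  (fun k => fb _).
rewrite (_ : (fun x => _) = fun x => a ord0 * f ord0 x +
    \sum_(k < n) a (lift ord0 k) * f (lift ord0 k) x); last first.
  by apply/funext => x; rewrite big_ord_recl.
by rewrite mean_linear// big_ord_recl ms; split=> //; exact: bounded_funZD.
Qed.

Lemma mean_norm_le (f : G -> R) (M : R) :
  (forall x, `|f x| <= M) -> `|m f| <= M.
Proof.
move=> fM; have fb : bounded_fun f by apply/bounded_funP; exists M.
case: mP => _ m_ge0 _ _.
have mle (a : R) : `|a| = 1 -> 0 <= a * m f + M.
  move=> a1; rewrite -[M in _ + M]mean_cst -mean_linear//; last first.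
    exact: bounded_fun_cst.
  apply: m_ge0 => [|x]; first exact: bounded_funZD fb (bounded_fun_cst M).
  have /ler_normlP[+ _] : `|a * f x| <= M by rewrite normrM a1 mul1r.
  lra.
have := mle 1 (normr1 _); have := mle (-1) (normrN1 _).
by move=> *; apply/ler_normlP; split; lra.
Qed.

End Mean.

Definition right_mean (R : realType) (G : groupType) (m : (G -> R) -> R)
  (f : G -> R) : R := m (fun x => f x^-1%g).

Section RightMean.
Context {R : realType} {G : groupType} {m : (G -> R) -> R}.
Hypothesis mP : left_invariant_mean m.

Lemma right_mean_translate (g : G) (f : G -> R) : bounded_fun f ->
  right_mean m (fun x => f (x * g)%g) = right_mean m f.
Proof.
move=> fb; case: mP => _ _ _ /(_ g^-1%g (fun x => f x^-1%g)).
move=> /(_ (bounded_fun_comp (fun x => x^-1%g) fb)).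
rewrite /right_mean => <-.
by congr m; apply/funext => x; rewrite invgM invgK.
Qed.

Lemma right_mean_cst (c : R) : right_mean m (fun=> c) = c.
Proof. exact: (mean_cst mP). Qed.

Lemma right_mean_sum n (a : 'I_n -> R) (f : 'I_n -> G -> R) :
  (forall k, bounded_fun (f k)) ->
  right_mean m (fun x => \sum_k a k * f k x) = \sum_k a k * right_mean m (f k).
Proof.
move=> fb; rewrite /right_mean -(mean_sum mP a (f := fun k x => f k x^-1%g))// => k.
exact: bounded_fun_comp (fb k).
Qed.

Lemma right_mean_norm_le (f : G -> R) (M : R) :
  (forall x, `|f x| <= M) -> `|right_mean m f| <= M.
Proof. by move=> fM; exact: (mean_norm_le mP). Qed.

End RightMean.

(** * Prepending a variable *)

Definition fcons (T : Type) n (x : T) (g : 'I_n -> T) : 'I_n.+1 -> T :=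
  fun i => oapp g x (unlift ord0 i).

Lemma fcons_lift (T : Type) n (x : T) (g : 'I_n -> T) i :
  fcons x g (lift ord0 i) = g i.
Proof. by rewrite /fcons liftK. Qed.

Lemma fcons_ord0 (T : Type) n (x : T) (g : 'I_n -> T) : fcons x g ord0 = x.
Proof. by rewrite /fcons unlift_none. Qed.

Section FaceFcons.
Variable G : groupType.

Lemma face0_fcons n (x : G) (g : 'I_n -> G) : face 0 (fcons x g) = g.
Proof. by apply/funext => i; rewrite /face /= fcons_lift. Qed.

Lemma face1_fcons n (x : G) (g : 'I_n.+1 -> G) :
  face 1 (fcons x g) = fcons (x * g ord0)%g (face 0 g).
Proof.
apply/funext => i; rewrite /face ltnS /= eqSS fcons_lift.
case: (unliftP ord0 i) => [j ->|->]; first by rewrite fcons_lift.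
rewrite eqxx fcons_ord0 (_ : widen_ord _ _ = ord0) ?fcons_ord0//.
exact/val_inj.
Qed.

Lemma faceS_fcons n k (x : G) (g : 'I_n.+1 -> G) :
  face k.+2 (fcons x g) = fcons x (face k.+1 g).
Proof.
apply/funext => i; rewrite /face !fcons_lift ltnS eqSS.
case: (unliftP ord0 i) => [j ->|->].
  rewrite fcons_lift.
  rewrite (_ : widen_ord _ (lift ord0 j) = lift ord0 (widen_ord (leqnSn n) j)).
    by rewrite fcons_lift.
  exact/val_inj.
rewrite fcons_ord0 /= (_ : widen_ord _ ord0 = ord0) ?fcons_ord0//.
exact/val_inj.
Qed.

End FaceFcons.

(** * Averaging over the first variable *)

Section Average.
Context {R : realType} {G : groupType} {m : (G -> R) -> R}.
Hypothesis mP : left_invariant_mean m.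

Definition average n (w : cochain R G n.+1) : cochain R G n :=
  fun g => right_mean m (fun x => w (fcons x g)).

Lemma p_bounded_fcons p n (w : cochain R G n.+1) : p_bounded p.+1 w ->
  forall c : 'I_n -> G, exists M : R, forall x g,
    (forall i : 'I_n, (p <= i)%N -> g i = c i) -> `|w (fcons x g)| <= M.
Proof.
(* The prepended entry has index 0 <= p, so that its value is immaterial. *)
move=> /p_boundedP wb c; have [M wM] := wb (fcons 1%g c).
exists M => x g gc; apply: wM => i.
by case: (unliftP ord0 i) => [j ->|-> //]; rewrite !fcons_lift => /gc.
Qed.

Lemma p_bounded_first p n (w : cochain R G n.+1) (g : 'I_n -> G) :
  p_bounded p.+1 w -> bounded_fun (fun x => w (fcons x g) : R).
Proof.
move=> /p_bounded_fcons /(_ g)[M wM].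
by apply/bounded_funP; exists M => x; exact: wM.
Qed.

Lemma p_bounded_average p n (w : cochain R G n.+1) :
  p_bounded p.+1 w -> p_bounded p (average w).
Proof.
move=> /p_bounded_fcons wb; apply/p_boundedP => c; have [M wM] := wb c.
by exists M => g gc; apply: (right_mean_norm_le mP) => x; exact: wM.
Qed.

Lemma cocycle_fcons n (w : cochain R G n.+1) (x : G) (g : 'I_n.+1 -> G) :
  codiff w = 0 ->
  w g = \sum_(k < n.+2) (-1) ^+ k * w (face k.+1 (fcons x g)).
Proof.
move=> /(congr1 (fun u => u (fcons x g))); rewrite codiffE big_ord_recl /=.
rewrite expr0 mul1r face0_fcons => /eqP; rewrite addr_eq0 => /eqP ->.
rewrite -sumrN; apply: eq_bigr => k _.
by rewrite /bump /= add1n exprS mulN1r mulNr opprK.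
Qed.

(** Right invariance is used for the face of index 0 only: it replaces
    [x * g ord0] by [x]; all the other faces commute with prepending. *)
Lemma average_face p n (w : cochain R G n.+1) (g : 'I_n.+1 -> G) k :
  p_bounded p.+1 w ->
  right_mean m (fun x => w (face k.+1 (fcons x g))) = average w (face k g).
Proof.
move=> wb; case: k => [|k]; last first.
  by congr right_mean; apply/funext => x; rewrite faceS_fcons.
rewrite /average -(right_mean_translate mP (g ord0) (p_bounded_first _ wb)).
by congr right_mean; apply/funext => x; rewrite face1_fcons.
Qed.

Lemma p_bounded_face p n (w : cochain R G n.+1) (g : 'I_n.+1 -> G) k :
  p_bounded p.+1 w -> bounded_fun (fun x => w (face k.+1 (fcons x g)) : R).
Proof.
move=> wb; case: k => [|k].
  rewrite (_ : (fun x => _) =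
      (fun x => w (fcons x (face 0 g)) : R) \o (fun x => x * g ord0)%g).
    exact: bounded_fun_comp (p_bounded_first _ wb).
  by apply/funext => x; rewrite face1_fcons.
rewrite (_ : (fun x => _) = fun x => w (fcons x (face k.+1 g)) : R).
  exact: p_bounded_first wb.
by apply/funext => x; rewrite faceS_fcons.
Qed.

Lemma codiff_average p n (w : cochain R G n.+1) :
  p_bounded p.+1 w -> codiff w = 0 -> codiff (average w) = w.
Proof.
move=> wb w0; apply/funext => g; rewrite codiffE -[RHS](right_mean_cst mP).
transitivity (right_mean m (fun x =>
    \sum_(k < n.+2) (-1) ^+ k * w (face k.+1 (fcons x g)))); last first.
  by congr right_mean; apply/funext => x; rewrite -cocycle_fcons.
have := right_mean_sum mP (fun k : 'I_n.+2 => (-1) ^+ k)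
  (fun k : 'I_n.+2 => p_bounded_face g k wb).
by move=> ->; apply: eq_bigr => k _; rewrite (average_face _ _ wb).
Qed.

End Average.

Theorem theorem2p1 (R : realType) (G : groupType) (hG : amenable R G)
    (n p : nat) (hn : (0 < n)%N) (hp : (1 <= p <= n)%N)
    (x : cohomology R G p n) :
  comparison R G p n x = 0.
Proof.
have [m mP] := hG.
case: n p hn hp x => [//|n] [//|p] _ _ x.
rewrite -[x]lquot_reprK comparison_class; move: (lquot_repr x) => z.
rewrite -[RHS](linear0 (@cohomology_class R G p n.+1)).
apply/lquot_piP; rewrite subr0; apply/asboolP => /=.
have wb : p_bounded p.+1 (z : cochain R G n.+1).
  exact/asboolP/(valP (cocycle_val z)).
have w0 : codiff (z : cochain R G n.+1) = 0.
  by have /eqP/(congr1 (@pcochain_val _ _ _ _)) := valP z.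
have ab : average (m := m) z \in pcochain_pred p (n:=n).
  exact/asboolP/(p_bounded_average mP).
by exists (PCochain ab); apply/val_inj; rewrite /= (codiff_average mP wb w0).
Qed.
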